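(* The quasi-order $\preccurlyeq_\omega$ is a universal countable Borel quasi-order: for every countable Borel quasi-order $Q$ on a standard Borel space $X$ there is a Borel map $f\colon X\to (2^{\mathbb{N}})^{M_\omega}$ with $x\mathbin{Q}y \Leftrightarrow f(x)\preccurlyeq_\omega f(y)$.
   Context: A countable Borel quasi-order is a quasi-order $Q$ on a standard Borel (e.g. Polish) space $X$ which is Borel as a subset of $X^2$ and such that for every $x\in X$ the set $\{y : y\mathbin{Q}x\}$ is countable. For quasi-orders $Q$ on $X$ and $Q'$ on $Y$, $Q\leq_B Q'$ means there is a Borel $f\colon X\to Y$ with $x\mathbin{Q}y\Leftrightarrow f(x)\mathbin{Q'}f(y)$; a countable Borel quasi-order is universal if every countable Borel quasi-order is $\leq_B$-below it. For a countable monoid $M$ and standard Borel space $X$, $M$ acts on $X^M$ by $(m\cdot f)(s)=f(sm)$, and $\preccurlyeq_M^X$ is the quasi-order $f\preccurlyeq_M^X g\Leftrightarrow \exists m\in M\ f=m\cdot g$. $M_\omega$ is the free monoid on countably many generators and $\preccurlyeq_\omega$ denotes $\preccurlyeq_{M_\omega}^{2^{\mathbb{N}}}$. *)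

(* Defs.v *)
From HB Require Import structures.
From mathcomp Require Import all_boot all_order all_algebra.
From mathcomp Require Import all_classical all_reals all_analysis.

Set Implicit Arguments.
Unset Strict Implicit.
Unset Printing Implicit Defensive.

Local Open Scope classical_set_scope.

(* [measurableType] and [completeType] extend [pointedType] and so exclude the
   empty space; below, a measurable space is a type together with an explicit set of sets. *)

Definition borel (T : topologicalType) : set (set T) := <<s open >>.
Arguments borel T : clear implicits.

Definition borel_map (X Y : Type) (SX : set (set X)) (SY : set (set Y))
    (f : X -> Y) : Prop :=
  forall B, SY B -> SX (f @^-1` B).

Definition prod_sigma (X Y : Type) (SX : set (set X)) (SY : set (set Y)) :
    set (set (X * Y)) :=
  <<s [set C | exists A B, [/\ SX A, SY B & C = A `*` B]] >>.

Definition power_sigma (I X : Type) (SX : set (set X)) : set (set (I -> X)) :=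
  <<s [set C | exists i B, SX B /\ C = (fun f : I -> X => f i) @^-1` B] >>.

Definition separable (T : topologicalType) : Prop :=
  exists2 D : set T, countable D & dense D.

Definition complete_space (T : uniformType) : Prop :=
  forall F : set_system T, ProperFilter F -> cauchy F -> exists l : T, F --> l.

(* Isomorphic, as a measurable space, to the Borel space of a Polish space,
   the latter being presented by a complete separable metric. *)
Definition standard_borel (R : realType) (X : Type) (SX : set (set X)) : Prop :=
  exists (P : metricType R) (f : X -> P) (g : P -> X),
    [/\ complete_space P, separable P, cancel f g, cancel g f &
        borel_map SX (borel P) f /\ borel_map (borel P) SX g].

Definition quasi_order (X : Type) (Q : X -> X -> Prop) : Prop :=
  (forall x, Q x x) /\ (forall x y z, Q x y -> Q y z -> Q x z).

Definition countable_borel_quasi_order (R : realType) (X : Type)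
    (SX : set (set X)) (Q : X -> X -> Prop) : Prop :=
  [/\ standard_borel R SX,
      quasi_order Q,
      prod_sigma SX SX [set p | Q p.1 p.2] &
      forall x, countable [set y | Q y x]].

Definition borel_reducible (X Y : Type) (SX : set (set X)) (SY : set (set Y))
    (Q : X -> X -> Prop) (Q' : Y -> Y -> Prop) : Prop :=
  exists2 f : X -> Y,
    borel_map SX SY f & forall x y, Q x y <-> Q' (f x) (f y).

Definition universal_countable_borel_quasi_order (R : realType) (Y : Type)
    (SY : set (set Y)) (Q' : Y -> Y -> Prop) : Prop :=
  countable_borel_quasi_order R SY Q' /\
  forall (X : Type) (SX : set (set X)) (Q : X -> X -> Prop),
    countable_borel_quasi_order R SX Q -> borel_reducible SX SY Q Q'.

Definition monoid_shift (M : monoidType) (X : Type) (m : M) (f : M -> X) : M -> X :=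
  fun s => f (s * m)%g.

Definition monoid_shift_le (M : monoidType) (X : Type) (f g : M -> X) : Prop :=
  exists m : M, f = monoid_shift m g.

(* The free monoid on the generators [:: n], n : nat. *)
Definition Momega : Type := seq nat.
HB.instance Definition _ := Countable.on Momega.
HB.instance Definition _ :=
  isMonoid.Build Momega (@catA nat) (@cat0s nat) (@cats0 nat).

Definition preceq_omega (f g : Momega -> cantor_space) : Prop :=
  monoid_shift_le f g.

Definition borel_omega : set (set (Momega -> cantor_space)) :=
  power_sigma (borel cantor_space).

(* Main.v *)
From HB Require Import structures.
Require Import Defs.
From mathcomp Require Import all_boot all_order all_algebra.
From mathcomp Require Import all_classical all_reals all_analysis.
From mathcomp Require Import zify.

(** A standard Borel space is coded by integer sequences: [x] is sent to the
   sequence of the least indices [i] such that the [i]-th point of a dense sequence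
   is [1/(j+1)]-close to [x].  A countable Borel quasi-order [Q] becomes a Borel
   subset of the square of the Baire space with countable sections, and the
   Lusin-Novikov theorem covers it by graphs of Borel functions; hence there are
   Borel maps [T n] with [{y | y Q x} = {T n x | n}].  These maps define an action
   of the free monoid, and [x |-> (w |-> w . x)], read through the code, is
   equivariant and injective, so it reduces [Q] to the shift quasi-order.

   Lusin-Novikov is proved without transfinite derivatives.  Finite approximations
   to finite subsets of a section are countable in number, so one countable family
   [fs] of Borel functions suffices for all those approximations that some
   countable family can kill.  A point outside the graphs of [fs] can then be split
   repeatedly, because the points of a leaf that could not be split would form an
   analytic graph, which by Lusin separation lies on the graph of one Borel function.
   The splittings converge to a perfect subset of a single section. *)

Set Implicit Arguments.
Unset Strict Implicit.
Unset Printing Implicit Defensive.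

Local Open Scope classical_set_scope.

(** * Sigma-algebras *)

Section SigmaAlgebra.
Context {T : Type} (S : set (set T)) (saS : sigma_algebra setT S).

(** The closure properties go connective by connective, so that a measurability proof follows the
    formula defining the set; quantifiers range over any countable type. *)
Lemma sa_not (A : set T) : S A -> S [set x | ~ A x].
Proof. by case: saS => _ SC _ /SC; rewrite setTD. Qed.

Lemma sa_exists (K : countType) (A : K -> set T) :
  (forall k, S (A k)) -> S [set x | exists k, A k x].
Proof.
have [S0 _ SU] := saS; move=> SA.
pose B n := if unpickle n is Some k then A k else set0.
suff -> : [set x | exists k, A k x] = \bigcup_n B n.
  by apply: SU => n; rewrite /B; case: unpickle.
apply/seteqP; split=> [x [k Akx]|x [n _]].
  by exists (pickle k) => //; rewrite /B pickleK.
by rewrite /B; case: unpickle => // k Akx; exists k.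
Qed.

Lemma sa_forall (K : countType) (A : K -> set T) :
  (forall k, S (A k)) -> S [set x | forall k, A k x].
Proof.
move=> SA; suff -> : [set x | forall k, A k x] = [set x | ~ exists k, ~ A k x].
  by apply: sa_not; apply: sa_exists => k; apply: sa_not.
by apply/seteqP; split=> [x Ax [k]|x nx k]; [exact|apply: contra_notP nx; exists k].
Qed.

Lemma sa_and (A B : set T) : S A -> S B -> S [set x | A x /\ B x].
Proof.
move=> SA SB.
suff -> : [set x | A x /\ B x] = [set x | forall b : bool, (if b then A else B) x].
  by apply: sa_forall; case.
by apply/seteqP; split=> [x [Ax Bx] []|x AB]//; split; [exact: (AB true)|exact: (AB false)].
Qed.

Lemma sa_or (A B : set T) : S A -> S B -> S [set x | A x \/ B x].
Proof.
move=> SA SB.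
suff -> : [set x | A x \/ B x] = [set x | exists b : bool, (if b then A else B) x].
  by apply: sa_exists; case.
by apply/seteqP; split=> [x [Ax|Bx]|x [[] Ax]]; [exists true|exists false|left|right].
Qed.

Lemma sa_cst (P : Prop) : S [set _ | P].
Proof.
have [S0 _ _] := saS; case: (pselect P) => p.
  suff -> : [set _ : T | P] = [set x | ~ set0 x] by exact: sa_not.
  by apply/seteqP; split=> x /=; auto.
by suff -> : [set _ : T | P] = set0 by []; apply/seteqP; split.
Qed.

Lemma sa_imply (P : Prop) (A : set T) : (P -> S A) -> S [set x | P -> A x].
Proof.
move=> SA; case: (pselect P) => p.
  by suff -> : [set x | P -> A x] = A; [exact: SA|apply/seteqP; split=> x /=; auto].
suff -> : [set x | P -> A x] = [set _ | True] by exact: sa_cst.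
by apply/seteqP; split=> x /= *; [|exfalso; auto].
Qed.

Lemma generated_preimage (U : Type) (G : set (set U)) (f : T -> U) :
  (forall B, G B -> S (f @^-1` B)) -> forall B, <<s G >> B -> S (f @^-1` B).
Proof.
move=> Gf; apply: (@smallest_sub _ _ _ [set B | S (f @^-1` B)]); last exact: Gf.
have [S0 SC SU] := saS; split=> /=; first by rewrite preimage_set0.
- by move=> A SA; rewrite setTD -preimage_setC -setTD; exact: SC.
- by move=> A SA; rewrite preimage_bigcup; exact: SU.
Qed.

End SigmaAlgebra.

Lemma sa_eq (T : Type) (S : set (set T)) (A B : set T) :
  S A -> (forall x, A x <-> B x) -> S B.
Proof. by move=> SA AB; suff <- : A = B by []; apply/seteqP; split=> x /AB. Qed.

(* [least P] is [0] when [P] is empty. *)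
Definition least (P : nat -> Prop) : nat :=
  if pselect (exists n, `[< P n >]) is left e then ex_minn e else 0.

Lemma leastP (P : nat -> Prop) k :
  least P = k <->
  (P k /\ forall j, (j < k)%N -> ~ P j) \/ (k = 0 /\ forall j, ~ P j).
Proof.
rewrite /least; case: pselect => [e|ne].
  case: ex_minnP => m /asboolP Pm mmin; split=> [<-|[[Pk kmin]|[_ nP]]].
  - left; split=> // j jm Pj; have := mmin j (asboolT Pj).
    by rewrite leqNgt jm.
  - apply/eqP; rewrite eqn_leq mmin ?asboolT //= leqNgt; apply/negP => mk.
    exact: kmin mk Pm.
  - by have := nP m.
split=> [<-|[[Pk _]|[-> //]]]; last by case: ne; exists k; apply/asboolP.
by right; split=> // j Pj; case: ne; exists j; apply/asboolP.
Qed.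

Lemma least_spec (P : nat -> Prop) : (exists k, P k) -> P (least P).
Proof. by move=> [k Pk]; have [/(_ erefl)[[]//|[_ /(_ k)]]] := leastP P (least P). Qed.

Lemma sa_least (T : Type) (S : set (set T)) (P : T -> nat -> Prop) k :
  sigma_algebra setT S -> (forall j, S [set x | P x j]) ->
  S [set x | least (P x) = k].
Proof.
move=> saS SP.
apply: (@sa_eq _ _ [set x | (P x k /\ forall j, (j < k)%N -> ~ P x j) \/
                            (k = 0 /\ forall j, ~ P x j)]); last first.
  by move=> x; split=> /leastP.
apply: sa_or => //; apply: sa_and => //.
- exact: SP.
- apply: (sa_forall saS (A := fun j => [set x | (j < k)%N -> ~ P x j])) => j.
  by apply: (sa_imply saS (A := [set x | ~ P x j])) => _; exact: (sa_not saS (SP j)).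
- exact: sa_cst.
- by apply: (sa_forall saS (A := fun j => [set x | ~ P x j])) => j; exact: (sa_not saS (SP j)).
Qed.

(** * Borel sets of integer sequences *)

Definition seq_borel (I : Type) : set (set (I -> nat)) :=
  <<s [set A | exists i k, A = [set z | z i = k]] >>.
Arguments seq_borel I : clear implicits.

Lemma seq_borel_sa I : sigma_algebra setT (seq_borel I).
Proof. exact: smallest_sigma_algebra. Qed.
#[local] Hint Resolve seq_borel_sa : core.

Lemma seq_borel_coord I (i : I) k : seq_borel I [set z | z i = k].
Proof. by apply: sub_sigma_algebra; exists i, k. Qed.

Definition coord_measurable (T J : Type) (S : set (set T)) (f : T -> J -> nat) :=
  forall j k, S [set x | f x j = k].

Lemma coord_measurable_preimage (T J : Type) (S : set (set T)) (f : T -> J -> nat) :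
  sigma_algebra setT S -> coord_measurable S f ->
  forall B, seq_borel J B -> S (f @^-1` B).
Proof. by move=> saS mf; apply: generated_preimage => // B [j [k ->]]; exact: mf. Qed.

(** A pair of integer sequences is again an integer sequence, over the sum of the index types, so
    products need no separate notion. *)
Definition copair (I J : Type) (x : I -> nat) (y : J -> nat) : I + J -> nat :=
  fun s => match s with inl i => x i | inr j => y j end.

Lemma copair_measurable (T I J : Type) (S : set (set T)) (f : T -> I -> nat)
    (g : T -> J -> nat) : coord_measurable S f -> coord_measurable S g ->
  coord_measurable S (fun x => copair (f x) (g x)).
Proof. by move=> mf mg [i|j] k /=; [exact: mf|exact: mg]. Qed.

(** * Closed and analytic sets of integer sequences *)

(* Closed for the product topology of the discrete topologies. *)
Definition pclosed (I : eqType) (F : set (I -> nat)) : Prop :=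
  forall z, (forall s : seq I, exists2 z', F z' & {in s, z =1 z'}) -> F z.

Lemma pclosed_reindex (I J : eqType) (r : J -> I) (F : set (J -> nat)) :
  pclosed F -> pclosed [set z : I -> nat | F (z \o r)].
Proof.
move=> cF z zF; apply: cF => s; have [z' Fz' zz'] := zF (map r s).
by exists (z' \o r) => // j js /=; apply: zz'; exact: map_f.
Qed.

Lemma pclosed_forall (I : eqType) (K : Type) (F : K -> set (I -> nat)) :
  (forall k, pclosed (F k)) -> pclosed [set z | forall k, F k z].
Proof.
move=> cF z zF k; apply: cF => s; have [z' Fz' zz'] := zF s.
by exists z'.
Qed.

(** The sets where [z i = k] form a clopen partition, so closed pieces, one in each cell, have a
    closed union. *)
Lemma pclosed_at (I : eqType) (i : I) (F : nat -> set (I -> nat)) :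
  (forall k, pclosed (F k)) -> pclosed [set z | F (z i) z].
Proof.
move=> cF z zF; apply: (cF (z i)) => s; have [z' /= Fz' zz'] := zF (i :: s).
exists z'; first by rewrite zz' ?mem_head.
by move=> j js; apply: zz'; rewrite inE js orbT.
Qed.

Lemma pclosed_cst (I : eqType) (P : Prop) : pclosed [set _ : I -> nat | P].
Proof. by move=> z /(_ [::])[]. Qed.

Lemma pclosed_coord (I : eqType) (i : I) (P : nat -> Prop) :
  pclosed [set z : I -> nat | P (z i)].
Proof. exact: (@pclosed_at _ i (fun k => [set _ | P k]) (fun _ => @pclosed_cst _ _)). Qed.

Lemma pclosed_and (I : eqType) (F G : set (I -> nat)) :
  pclosed F -> pclosed G -> pclosed [set z | F z /\ G z].
Proof.
move=> cF cG z zF; split; [apply: cF|apply: cG] => s;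
  by have [z' [Fz' Gz'] zz'] := zF s; exists z'.
Qed.

Lemma pclosed_prefix (I : eqType) (rank : I -> nat) (F : set (I -> nat)) z :
  pclosed F ->
  (forall n, exists2 z', F z' & forall i, (rank i < n)%N -> z i = z' i) -> F z.
Proof.
move=> cF zF; apply: cF => s; have [z' Fz' zz'] := zF (\max_(i <- s) rank i).+1.
by exists z' => // i iS; apply: zz'; rewrite ltnS; exact: leq_bigmax_seq.
Qed.

Definition analytic (I : eqType) (A : set (I -> nat)) : Prop :=
  exists F : set (I + nat -> nat),
    pclosed F /\ forall x, A x <-> exists g, F (copair x g).

Lemma analytic_eq (I : eqType) (A B : set (I -> nat)) :
  analytic A -> (forall x, A x <-> B x) -> analytic B.
Proof.
by move=> aA AB; suff <- : A = B by []; apply/seteqP; split=> x /AB.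
Qed.

Lemma analytic_proj (I : eqType) (K : countType) (F : set (I + K -> nat)) :
  pclosed F -> analytic [set x | exists g, F (copair x g)].
Proof.
move=> cF.
pose r (s : I + K) : I + nat := match s with inl i => inl i | inr k => inr (pickle k) end.
have copr x g : copair x g \o r = copair x (g \o pickle) by apply/funext => -[].
exists [set z : I + nat -> nat | F (z \o r)]; split=> [|x /=]; first exact: pclosed_reindex.
split=> [[g Fg]|[g]]; last by rewrite copr => Fg; exists (g \o pickle).
exists (fun n => if unpickle n is Some k then g k else 0); rewrite copr.
by suff -> : (fun n => if unpickle n is Some k then g k else 0) \o pickle = g;
  [|apply/funext => k /=; rewrite pickleK].
Qed.

Lemma analytic_closed (I : eqType) (F : set (I -> nat)) : pclosed F -> analytic F.
Proof.
move=> cF; exists [set z : I + nat -> nat | F (z \o inl)]; split=> [|x].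
  exact: pclosed_reindex.
by split=> [Fx|[g]]//; exists (fun=> 0).
Qed.

Lemma analytic_forall (I : eqType) (K : countType) (A : K -> set (I -> nat)) :
  (forall k, analytic (A k)) -> analytic [set x | forall k, A k x].
Proof.
move=> /choice[F /all_and2[cF AF]].
pose r k (s : I + nat) : I + K * nat :=
  match s with inl i => inl i | inr n => inr (k, n) end.
have copr k (x : I -> nat) g : copair x g \o r k = copair x (fun n => g (k, n)).
  by apply/funext => -[].
have cF' : pclosed [set z : I + K * nat -> nat | forall k, F k (z \o r k)].
  by apply: pclosed_forall => k; exact: pclosed_reindex.
apply: analytic_eq (analytic_proj cF') _ => x /=; split=> [[g Fg] k|Ax].
  by apply/AF; exists (fun n => g (k, n)); rewrite -copr.
have [g Fg] := choice (fun k => (AF k x).1 (Ax k)).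
by exists (fun p => g p.1 p.2) => k; rewrite copr.
Qed.

(** The extra coordinate [None] of the witness stores the code of [k]; by [pclosed_at] it selects
    the closed set that the rest must satisfy. *)
Lemma analytic_exists (I : eqType) (K : countType) (A : K -> set (I -> nat)) :
  (forall k, analytic (A k)) -> analytic [set x | exists k, A k x].
Proof.
move=> /choice[F /all_and2[cF AF]].
pose r (s : I + nat) : I + option nat :=
  match s with inl i => inl i | inr n => inr (Some n) end.
have copr (x : I -> nat) g : copair x g \o r = copair x (g \o some).
  by apply/funext => -[].
pose G n : set (I + option nat -> nat) :=
  if unpickle n is Some k then [set z : I + option nat -> nat | F k (z \o r)] else [set _ | False].
have cF' : pclosed [set z : I + option nat -> nat | G (z (inr None)) z].
  apply: pclosed_at => n; rewrite /G; case: unpickle => [k|].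
    exact: pclosed_reindex.
  exact: pclosed_cst.
apply: analytic_eq (analytic_proj cF') _ => x /=; split=> [[g]|[k /AF[g Fg]]].
  rewrite /G /=; case: unpickle => //= k; rewrite copr => Fk.
  by exists k; apply/AF; exists (g \o some).
exists (fun o => if o is Some n then g n else pickle k).
by rewrite /G /= pickleK /= copr.
Qed.

Lemma analytic_and (I : eqType) (A B : set (I -> nat)) :
  analytic A -> analytic B -> analytic [set x | A x /\ B x].
Proof.
move=> aA aB.
have aAB (b : bool) : analytic (if b then A else B) by case: b.
apply: analytic_eq (analytic_forall aAB) _ => x.
by split=> [AB|[Ax Bx] []//]; split; [exact: (AB true)|exact: (AB false)].
Qed.

Lemma analytic_ex_fun (I : eqType) (K : countType) (A : set (I + K -> nat)) :
  analytic A -> analytic [set x | exists y, A (copair x y)].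
Proof.
move=> [F [cF AF]].
pose r (s : (I + K) + nat) : I + (K + nat) :=
  match s with inl (inl i) => inl i | inl (inr k) => inr (inl k) | inr n => inr (inr n) end.
have cF' : pclosed [set z : I + (K + nat) -> nat | F (z \o r)].
  exact: pclosed_reindex.
apply: analytic_eq (@analytic_proj I (K + nat)%type _ cF') _ => x /=.
have copr (g : K + nat -> nat) :
    copair x g \o r = copair (copair x (g \o inl)) (g \o inr).
  by apply/funext => -[[]|].
split=> [[g]|[y /AF[g Fg]]].
  by rewrite copr => Fg; exists (g \o inl); apply/AF; exists (g \o inr).
by exists (copair y g); rewrite copr.
Qed.

(** The sets that are analytic together with their complement form a sigma-algebra containing the
    generators. *)
Lemma analytic_borel (I : eqType) (A : set (I -> nat)) : seq_borel I A -> analytic A.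
Proof.
suff : seq_borel I `<=` [set A | analytic A /\ analytic [set x | ~ A x]].
  by move=> /[apply] -[].
apply: smallest_sub; last first.
  move=> _ [i [k ->]]; split; apply: analytic_closed.
    exact: (@pclosed_coord _ i (fun m => m = k)).
  exact: (@pclosed_coord _ i (fun m => m <> k)).
split=> /=.
- by split; apply: analytic_closed; exact: pclosed_cst.
- move=> B [aB aBC]; rewrite setTD; split=> //; apply: analytic_eq aB _ => x.
  by split=> [Bx []//|nB]; apply: contrapT => nBx; apply: nB.
- move=> B /all_and2[aB aBC]; split.
    apply: analytic_eq (analytic_exists aB) _ => x.
    by split=> [[n Bx]|[n _ Bx]]; exists n.
  apply: analytic_eq (analytic_forall aBC) _ => x.
  by split=> [nB [n _]|nB n Bx]; [exact: nB|apply: nB; exists n].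
Qed.

(** * Lusin separation of analytic sets *)

Lemma infinite_branch (T : Type) (P : seq T -> Prop) :
  P [::] -> (forall s, P s -> exists a, P (rcons s a)) ->
  exists t : nat -> T, forall n, P (mkseq t n).
Proof.
move=> P0 PS; have [a0 _] := PS _ P0.
have /choice[next nextP] : forall s, exists a, P s -> P (rcons s a).
  by move=> s; case: (pselect (P s)) => [/PS[a Pa]|nP]; [exists a|exists a0].
pose b n := iter n (fun s => rcons s (next s)) [::].
exists (fun n => next (b n)) => n.
suff -> : mkseq (fun n => next (b n)) n = b n.
  by elim: n => //= n IH; exact: nextP.
by elim: n => // n IH; rewrite mkseqS IH.
Qed.

Definition borel_separated (I : Type) (A B : set (I -> nat)) : Prop :=
  exists D, [/\ seq_borel I D, forall x, A x -> D x & forall x, B x -> ~ D x].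

(* Lusin: two analytic sets that are not Borel-separable have approximations
   that are not Borel-separable at every finite stage, which yields a common point. *)
Lemma analytic_separation (A B : set (nat -> nat)) :
  analytic A -> analytic B -> (forall x, A x -> ~ B x) -> borel_separated A B.
Proof.
move=> [F [cF AF]] [G [cG BG]] AB; apply: contrapT => nsep.
(* Each entry of a node [s] holds a value of the point, of its witness for [A] and of its witness
   for [B]. *)
pose d : nat * nat * nat := (0, 0, 0).
pose approx (H : set (nat + nat -> nat)) (pr : nat * nat * nat -> nat) s :=
  [set x : nat -> nat | (forall i, (i < size s)%N -> x i = (nth d s i).1.1) /\
    exists2 g, (forall i, (i < size s)%N -> g i = pr (nth d s i)) & H (copair x g)].
have approx_rcons H pr s x g a b b' : (forall i, (i < size s)%N -> x i = (nth d s i).1.1) ->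
    (forall i, (i < size s)%N -> g i = pr (nth d s i)) -> H (copair x g) ->
    x (size s) = a -> g (size s) = pr (a, b, b') ->
    approx H pr (rcons s (a, b, b')) x.
  move=> xs gs Hxg xa ga; split=> [i|]; last exists g => // i;
    rewrite size_rcons ltnS leq_eqVlt nth_rcons => /orP[/eqP ->|ilt]; by rewrite ?ltnn ?eqxx ?ilt; auto.
pose AA := approx F (fun t => t.1.2); pose BB := approx G (fun t => t.2).
have [|s|t tP] := @infinite_branch _ (fun s => ~ borel_separated (AA s) (BB s)).
- apply: contra_not nsep => -[D [bD AD BD]]; exists D; split=> // x.
    by move=> /AF[g Fg]; apply: AD; split=> //; exists g.
  by move=> /BG[g Gg]; apply: BD; split=> //; exists g.
- apply: contra_notP => /forallNP nP.
  have [D DP] := choice (fun a => contrapT (nP a)).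
  (* If sets [D] separate all children of [s], then [s] is separated by a union over the values of
     the point and the first witness of intersections over the values of the second. *)
  exists [set x | exists ab : nat * nat, x (size s) = ab.1 /\ forall b', D (ab.1, ab.2, b') x].
  split.
  + apply: sa_exists => // ab. apply: (sa_and (seq_borel_sa _)); first exact: seq_borel_coord.
    by apply: sa_forall => // b'; case: (DP (ab.1, ab.2, b')).
  + move=> x [xs [g gs Fxg]]; exists (x (size s), g (size s)); split=> // b'.
    by case: (DP (x (size s), g (size s), b')) => _ + _; apply; exact: approx_rcons Fxg _ _.
  + move=> x [xs [g gs Gxg]] [[a b] /= [xa /(_ (g (size s)))]].
    by case: (DP (a, b, g (size s))) => _ _; apply; exact: approx_rcons Gxg _ _.
(* Along the branch no approximation is empty, since an empty one is trivially separated from the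
   other; closedness then puts [x] in both [A] and [B]. *)
- pose x i := (t i).1.1; pose g i := (t i).1.2; pose h i := (t i).2.
  pose rank (s : nat + nat) := match s with inl i => i | inr i => i end.
  have lim H pr (u : nat -> nat) : pclosed H -> (forall i, u i = pr (t i)) ->
      (forall n, exists y, approx H pr (mkseq t n) y) -> H (copair x u).
    move=> cH ut ne; apply: (@pclosed_prefix _ rank _ _ cH) => n.
    have [y [yn [v vn Hyv]]] := ne n; exists (copair y v) => //.
    by case=> i /= ilt; rewrite ?yn ?vn ?size_mkseq ?nth_mkseq// ut.
  apply: (AB x).
    apply/AF; exists g; apply: (lim _ (fun t => t.1.2) _ cF) => // n.
    apply: contra_notP (tP n) => /forallNP nA; exists [set _ | False]; split=> //.
      exact: sa_cst.
    by move=> y _ [].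
  apply/BG; exists h; apply: (lim _ (fun t => t.2) _ cG) => // n.
  apply: contra_notP (tP n) => /forallNP nB; exists [set _ | True]; split=> //.
    exact: sa_cst.
  by move=> y By; case: (nB y By).
Qed.

(** By uniqueness of [y], the analytic sets of [x] with [y n = k] and with [y n <> k] are disjoint;
    the Borel sets separating them determine [y n]. *)
Lemma analytic_graph_borel_fun (A : set (nat + nat -> nat)) :
  analytic A ->
  (forall x y y', A (copair x y) -> A (copair x y') -> y = y') ->
  exists f : (nat -> nat) -> nat -> nat, coord_measurable (seq_borel nat) f /\
    forall x y, A (copair x y) -> y = f x.
Proof.
move=> aA Agraph.
have an (P : nat -> Prop) n : analytic [set x | exists y, A (copair x y) /\ P (y n)].
  have aP : analytic [set z : nat + nat -> nat | A z /\ P (z (inr n))].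
    by apply: analytic_and => //; apply: analytic_closed; exact: pclosed_coord.
  exact: analytic_ex_fun aP.
have sep (p : nat * nat) := analytic_separation
  (an (fun m => m = p.2) p.1) (an (fun m => m <> p.2) p.1)
  (fun x '(ex_intro y (conj Ay yk)) '(ex_intro y' (conj Ay' yk')) =>
     yk' (eq_ind y (fun v => v p.1 = p.2) yk y' (Agraph _ _ _ Ay Ay'))).
have [D DP] := choice sep.
exists (fun x n => least (fun k => D (n, k) x)); split=> [n k|x y Axy].
  by apply: sa_least => // j; case: (DP (n, j)).
apply/funext => n; apply/esym/leastP; left.
have Dn k : D (n, k) x -> y n = k.
  case: (DP (n, k)) => _ _ /(_ x) nD Dx; apply: contrapT => ynk.
  by apply: nD => //; exists y.
split; last by move=> j jn /Dn yj; rewrite yj ltnn in jn.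
by case: (DP (n, y n)) => _ + _; apply; exists y.
Qed.

Lemma analytic_imply (I : eqType) (P : Prop) (A : set (I -> nat)) :
  (P -> analytic A) -> analytic [set x | P -> A x].
Proof.
move=> aA; case: (pselect P) => p.
  by apply: analytic_eq (aA p) _ => x; split=> [Ax _|]//; exact.
by apply: analytic_eq (analytic_closed (@pclosed_cst _ True)) _ => x; split=> // _ /p.
Qed.

Lemma pclosed_eq_coord (I : eqType) (i j : I) : pclosed [set z : I -> nat | z i = z j].
Proof.
apply: (@pclosed_at _ i (fun k => [set z | k = z j])) => k.
exact: (@pclosed_coord _ j (fun m => k = m)).
Qed.

Lemma countable_enum (T : Type) (A : set T) (x0 : T) :
  countable A -> exists z : nat -> T, forall y, A y -> exists m, z m = y.
Proof.
move=> /countable_injP[f finj].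
have /choice[z zP] : forall m, exists y, (exists2 y', A y' & f y' = m) -> A y /\ f y = m.
  move=> m; case: (pselect (exists2 y', A y' & f y' = m)) => [[y Ay fy]|nA].
    by exists y.
  by exists x0.
exists z => y Ay; exists (f y); have [|Az fz] := zP (f y); first by exists y.
by apply: finj => //; exact/mem_set.
Qed.

(** * The Lusin-Novikov theorem *)

Section LusinNovikov.

Local Notation baire := (nat -> nat).
(* The leaf [i] is a pair of a point [y_i] of the section and a witness of membership. *)
Local Notation leaves := (nat -> baire * baire).

Definition agree (n : nat) (u v : baire) := forall m, (m < n)%N -> u m = v m.

Definition agree2 (n : nat) (p q : baire * baire) :=
  agree n p.1 q.1 /\ agree n p.2 q.2.

Lemma agree2_sym n p q : agree2 n p q -> agree2 n q p.
Proof. by move=> [pq1 pq2]; split=> m mn; rewrite ?pq1 ?pq2. Qed.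

Lemma agree2_trans n p q r : agree2 n p q -> agree2 n q r -> agree2 n p r.
Proof. by move=> [pq1 pq2] [qr1 qr2]; split=> m mn; rewrite ?pq1 ?pq2 ?qr1 ?qr2. Qed.

Lemma agree2_le n n' p q : (n <= n')%N -> agree2 n' p q -> agree2 n p q.
Proof. by move=> nn' [pq1 pq2]; split=> m mn; rewrite ?pq1 ?pq2 // (leq_trans mn). Qed.

Variable F : set (nat + nat + nat -> nat).
Hypothesis cF : pclosed F.

Let Fpt (x : baire) (p : baire * baire) := F (copair (copair x p.1) p.2).

Lemma pclosed_limit x p :
  (forall n, exists x' p', [/\ Fpt x' p', agree n x x' & agree2 n p p']) -> Fpt x p.
Proof.
move=> lim.
pose rank (s : nat + nat + nat) := match s with inl (inl i) | inl (inr i) | inr i => i end.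
apply: (@pclosed_prefix _ rank) => // n.
have [x' [p' [Fp xx' [pp1 pp2]]]] := lim n.
exists (copair (copair x' p'.1) p'.2) => //.
by case=> [[i|i]|i] /=; [exact: xx'|exact: pp1|exact: pp2].
Qed.

(** A diagonal argument: against an enumeration [z] of the section, step [m] moves to a nearby leaf
    whose point differs from [z m] and freezes a coordinate showing it. The limit lies in the
    section but is not enumerated. *)
Lemma perfect_section_uncountable x (L : leaves) :
  (forall i, Fpt x (L i)) ->
  (forall i n, exists i', agree2 n (L i) (L i') /\ (L i).1 <> (L i').1) ->
  ~ countable [set y | exists g, Fpt x (y, g)].
Proof.
move=> LF Lperf /(countable_enum (fun=> 0))[z zP].
have /choice[next nextP] : forall msn : nat * (nat * nat), exists in' : nat * nat,
    [/\ (msn.2.2 < in'.2)%N, agree2 msn.2.2 (L msn.2.1) (L in'.1) &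
        exists2 q, (q < in'.2)%N & z msn.1 q <> (L in'.1).1 q].
  case=> m [i n] /=.
  have [i' [ii' neq]] : exists i', agree2 n (L i) (L i') /\ z m <> (L i').1.
    have [i' [ii' neq]] := Lperf i n.
    case: (pselect (z m = (L i).1)) => [->|zi]; first by exists i'.
    by exists i.
  have [q zq] : exists q, z m q <> (L i').1 q.
    by apply: contra_notP neq => /forallNP nq; apply/funext => q; exact: contrapT.
  exists (i', (n + q).+1) => /=; split=> //; first by lia.
  by exists q => //; lia.
pose st := fix st m := if m is m'.+1 then next (m', st m') else (0, 0).
have stS m : st m.+1 = next (m, st m) by [].
have st_ge m : (m <= (st m).2)%N.
  elim: m => // m IH; rewrite stS; have [] := nextP (m, st m) => /= + _ _; lia.
have st_agree m d : ((st m).2 <= (st (m + d)).2)%N /\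
    agree2 (st m).2 (L (st m).1) (L (st (m + d)).1).
  elim: d => [|d [IH1 IH2]]; first by rewrite addn0.
  rewrite addnS stS; have [/= lt ag _] := nextP (m + d, st (m + d)).
  split; first by lia.
  exact: agree2_trans IH2 (agree2_le IH1 ag).
(* Stage [m.+1] has precision at least [m.+1], so coordinate [m] is settled there. *)
pose p : baire * baire :=
  (fun m => (L (st m.+1).1).1 m, fun m => (L (st m.+1).1).2 m).
have pst m : agree2 (st m).2 p (L (st m).1).
  split=> q qm /=.
    have [_ [ag1 _]] := st_agree q.+1 m; have [_ [ag2 _]] := st_agree m q.+1.
    by rewrite ag2// addnC ag1// (leq_trans _ (st_ge q.+1)).
  have [_ [_ ag1]] := st_agree q.+1 m; have [_ [_ ag2]] := st_agree m q.+1.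
  by rewrite ag2// addnC ag1// (leq_trans _ (st_ge q.+1)).
have [|m zm] := zP p.1.
  exists p.2; apply: pclosed_limit => n; exists x, (L (st n).1); split=> //.
  exact: agree2_le (st_ge n) (pst n).
have [_ _ [q qlt]] := nextP (m, st m); rewrite -stS /= zm; apply.
by have [ag _] := pst m.+1; exact: ag.
Qed.

Definition measurable_family (f : nat -> baire -> baire) :=
  forall m, coord_measurable (seq_borel nat) (f m).

Definition avoiding (f : nat -> baire -> baire) k (x : baire) (L : leaves) :=
  forall i, (i < k)%N -> Fpt x (L i) /\ forall m, (L i).1 <> f m x.

Definition same k n (x : baire) (L : leaves) (x' : baire) (L' : leaves) :=
  agree n x x' /\ forall i, (i < k)%N -> agree2 n (L i) (L' i).

(** No measurable family kills a neighbourhood of a [k]-leaf configuration that survives [fs]: such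
    a configuration is approximated by others avoiding any given [f]. *)
Definition generic_family (fs : nat -> baire -> baire) :=
  forall k n x L, avoiding fs k x L -> forall f, measurable_family f ->
    exists x' L', avoiding f k x' L' /\ same k n x L x' L'.

(* There are only countably many finite approximations [a]; [fs] collects, for
   each [a] all of whose configurations are hit by a family, one such family. *)
Lemma exists_generic_family : exists2 fs, measurable_family fs & generic_family fs.
Proof.
pose key := (nat * nat * (seq nat * seq (seq nat * seq nat)))%type.
pose restr k n (x : baire) (L : leaves) : key :=
  (k, n, (mkseq x n, mkseq (fun i => (mkseq (L i).1 n, mkseq (L i).2 n)) k)).
have mkseq_agree n (u v : baire) : mkseq u n = mkseq v n -> agree n u v.
  by move=> uv m mn; rewrite -(nth_mkseq 0 u mn) uv nth_mkseq.
have restr_same k n x L x' L' : restr k n x L = restr k n x' L' -> same k n x L x' L'.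
  move=> [/mkseq_agree xx' LL']; split=> // i ik.
  have := nth_mkseq ([::], [::]) (fun i => (mkseq (L i).1 n, mkseq (L i).2 n)) ik.
  by rewrite LL' nth_mkseq// => -[/mkseq_agree ag1 /mkseq_agree ag2]; split=> m mn; rewrite ?ag1 ?ag2.
pose hits (a : key) f := forall x L, restr a.1.1 a.1.2 x L = a -> ~ avoiding f a.1.1 x L.
have /choice[fa faP] : forall a : key, exists fa, measurable_family fa /\
    forall f, measurable_family f -> hits a f -> hits a fa.
  move=> a; case: (pselect (exists2 f, measurable_family f & hits a f)).
    by move=> [f mf hf]; exists f.
  move=> nf; exists (fun _ x => x); split=> [m i k|f mf hf]; first exact: seq_borel_coord.
  by case: nf; exists f.
(* The families are merged: index [pickle (a, m)] holds the function [m] of the family chosen for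
   [a]. *)
exists (fun n => if unpickle n is Some am then fa am.1 am.2 else id).
  move=> n; case: (unpickle n) => [[a m]|]; first exact: (faP a).1.
  by move=> i k; exact: seq_borel_coord.
move=> k n x L av f mf; apply: contrapT => nex.
pose a := restr k n x L.
have ha : hits a f.
  move=> x' L' /= eqa av'; apply: nex; exists x', L'; split=> //.
  exact: restr_same (esym eqa).
apply: ((faP a).2 f mf ha x L) => // i ik; have [FL nf] := av i ik; split=> // m.
by have := nf (pickle (a, m)); rewrite pickleK.
Qed.

(** * Splitting leaves that avoid a generic family *)

Section Generic.
Variable fs : nat -> baire -> baire.
Hypotheses (mfs : measurable_family fs) (gfs : generic_family fs).

(** All leaves are stored in one integer sequence over a countable index type, so that they can be
    projected away; the bit selects the point or its witness. *)
Let decode (w : nat * nat * bool -> nat) : leaves :=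
  fun i => (fun m => w (i, m, true), fun m => w (i, m, false)).

(** Membership and agreement are closed conditions and avoidance is Borel; the leaves are then
    projected away. If leaf [j] cannot be split, this set is a graph. *)
Lemma analytic_leaf k n j x L : analytic [set z : nat + nat -> nat |
  exists L', [/\ avoiding fs k (z \o inl) L', same k n x L (z \o inl) L' &
                 z \o inr = (L' j).1]].
Proof.
pose K : countType := (nat * nat * bool)%type.
pose X (v : nat + nat + K -> nat) : baire := v \o inl \o inl.
pose W (v : nat + nat + K -> nat) := decode (v \o inr).
pose A := [set v | (forall i, (i < k)%N ->
                      Fpt (X v) (W v i) /\ forall m, ~ forall q, (W v i).1 q = fs m (X v) q) /\
                   (same k n x L (X v) (W v) /\
                    forall m, v (inl (inr m)) = v (inr (j, m, true)))].
have aA : analytic A.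
  apply: analytic_and; last apply: analytic_and.
  - apply: (analytic_forall (A := fun i => [set v | (i < k)%N ->
      Fpt (X v) (W v i) /\ forall m, ~ forall q, (W v i).1 q = fs m (X v) q])) => i.
    apply: (analytic_imply (A := [set v | Fpt (X v) (W v i) /\
      forall m, ~ forall q, (W v i).1 q = fs m (X v) q])) => _.
    apply: analytic_and.
      pose r (s : nat + nat + nat) : nat + nat + K :=
        match s with
        | inl (inl m) => inl (inl m)
        | inl (inr m) => inr (i, m, true)
        | inr m => inr (i, m, false)
        end.
      have E v : copair (copair (X v) (W v i).1) (W v i).2 = v \o r.
        by apply/funext => -[[]|].
      have cr : pclosed [set v : nat + nat + K -> nat | F (v \o r)].
        exact: (@pclosed_reindex (nat + nat + K)%type (nat + nat + nat)%type).
      by apply: analytic_eq (analytic_closed cr) _ => v; rewrite /Fpt E.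
    apply: (analytic_forall (A := fun m => [set v | ~ forall q, (W v i).1 q = fs m (X v) q])) => m.
    apply: analytic_borel.
    apply: (sa_not (seq_borel_sa _) (A := [set v | forall q, (W v i).1 q = fs m (X v) q])).
    apply: (sa_forall (seq_borel_sa _) (A := fun q => [set v | (W v i).1 q = fs m (X v) q])) => q.
    apply: (@sa_eq _ _ [set v | exists c, fs m (X v) q = c /\ v (inr (i, q, true)) = c]); last first.
      by move=> v; split=> [[c [e1 e2]]|e]; [rewrite /= e1 -e2|exists (fs m (X v) q); split=> //; rewrite -e].
    apply: (sa_exists (seq_borel_sa _)
      (A := fun c => [set v | fs m (X v) q = c /\ v (inr (i, q, true)) = c])) => c.
    apply: (sa_and (seq_borel_sa _) (A := [set v | fs m (X v) q = c]));
      last exact: seq_borel_coord.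
    have mX : coord_measurable (seq_borel (nat + nat + K)) X.
      by move=> l c'; exact: seq_borel_coord.
    exact: (coord_measurable_preimage (seq_borel_sa _) mX (mfs m q c)).
  - apply: analytic_closed; apply: pclosed_and.
      apply: (pclosed_forall (F := fun m => [set v | (m < n)%N -> x m = X v m])) => m.
      apply: (pclosed_forall (F := fun _ : (m < n)%N => [set v | x m = X v m])) => _.
      exact: (@pclosed_coord _ (inl (inl m)) (fun c => x m = c)).
    apply: (pclosed_forall (F := fun i => [set v | (i < k)%N -> agree2 n (L i) (W v i)])) => i.
    apply: (pclosed_forall (F := fun _ : (i < k)%N => [set v | agree2 n (L i) (W v i)])) => _.
    apply: pclosed_and.
      apply: (pclosed_forall (F := fun m => [set v | (m < n)%N -> (L i).1 m = v (inr (i, m, true))])) => m.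
      apply: (pclosed_forall (F := fun _ : (m < n)%N => [set v | (L i).1 m = v (inr (i, m, true))])) => _.
      exact: (@pclosed_coord _ (inr (i, m, true)) (fun c => (L i).1 m = c)).
    apply: (pclosed_forall (F := fun m => [set v | (m < n)%N -> (L i).2 m = v (inr (i, m, false))])) => m.
    apply: (pclosed_forall (F := fun _ : (m < n)%N => [set v | (L i).2 m = v (inr (i, m, false))])) => _.
    exact: (@pclosed_coord _ (inr (i, m, false)) (fun c => (L i).2 m = c)).
  - apply: analytic_closed; apply: pclosed_forall => m; exact: pclosed_eq_coord.
apply: analytic_eq (analytic_ex_fun (K := K) aA) _ => z; split.
  move=> [w [av [sm e]]]; exists (decode w); split=> //; last by apply/funext.
  move=> i ik; have [Fi ne] := av i ik; split=> // m eqm; apply: (ne m) => q.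
  by rewrite -[RHS](congr1 (fun u => u q) eqm).
move=> [L' [av sm e]].
exists (fun imb => if imb.2 then (L' imb.1.1).1 imb.1.2 else (L' imb.1.1).2 imb.1.2).
split; last split=> //; last by move=> m /=; rewrite -[RHS](congr1 (fun u => u m) e).
move=> i ik; have [Fi ne] := av i ik; split; first by rewrite /W /decode /= /Fpt /= in Fi *.
by move=> m eqm; apply: (ne m); apply/funext.
Qed.

(** Otherwise, configurations near [L] over the same base point share the point of leaf [j], so
    these points lie on the graph of one Borel [f]. Genericity against [f] together with [fs] gives
    a nearby configuration off that graph. *)
Lemma split_leaf k n j x L : (j < k)%N -> avoiding fs k x L ->
  exists x' L', [/\ avoiding fs k.+1 x' L', same k n x L x' L',
    agree2 n (L j) (L' k) & (L' j).1 <> (L' k).1].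
Proof.
move=> jk av; apply: contrapT => nex.
have [|f [mf fP]] := analytic_graph_borel_fun (analytic_leaf k n j x L).
  move=> x' y y' [L1 [av1 sm1 e1]] [L2 [av2 sm2 e2]].
  have {}e1 : y = (L1 j).1 := e1; have {}e2 : y' = (L2 j).1 := e2.
  have {}av1 : avoiding fs k x' L1 := av1; have {}av2 : avoiding fs k x' L2 := av2.
  have {}sm1 : same k n x L x' L1 := sm1; have {}sm2 : same k n x L x' L2 := sm2.
  rewrite e1 e2; apply: contrapT => neq; apply: nex.
  have jNk : (j == k) = false by lia.
  (* Leaf [j] of [L2] is appended to the first [k] leaves of [L1]. *)
  exists x', (fun i => if i == k then L2 j else L1 i); split=> //=.
  - move=> i; rewrite ltnS leq_eqVlt; case: eqP => [_ _|_ /= ik]; first exact: av2.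
    exact: av1.
  - have [xx' LL'] := sm1; split=> // i ik; rewrite (_ : (i == k) = false); last by lia.
    exact: LL'.
  - by rewrite eqxx; exact: sm2.2.
  - by rewrite eqxx jNk.
have [|x' [L' [av' sm']]] := gfs n av (f := fun m => if m is m'.+1 then fs m' else f).
  by case=> [|m]; [exact: mf|exact: mfs].
have [_ /(_ 0)] := av' j jk; apply; apply: fP; exists L'; split=> //.
by move=> i ik; have [Fi ne] := av' i ik; split=> // m; exact: (ne m.+1).
Qed.

(** Starting from the single leaf [(y, g)], every leaf is split at arbitrarily high precision. The
    base point moves too, so the uncountable section lies over the limit [X]; hence countability is
    assumed over every point. *)
Lemma generic_family_covers x y g :
  (forall x', countable [set y' | exists g', Fpt x' (y', g')]) ->
  Fpt x (y, g) -> exists m, y = fs m x.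
Proof.
move=> cnt Fxy; apply: contrapT => /forallNP ne.
pose state := (baire * leaves * nat)%type.
(* Stage [t] has the leaves [0] to [t]. The 2-adic valuation of [t.+1] is at most [t] and takes
   every value infinitely often. *)
pose leaf t := logn 2 t.+1.
have leafP t : (leaf t <= t)%N by rewrite -ltnS; exact: ltn_logl.
pose step t (a b : state) := [/\ (a.2 < b.2)%N,
  same t.+1 a.2 a.1.1 a.1.2 b.1.1 b.1.2,
  agree2 a.2 (a.1.2 (leaf t)) (b.1.2 t.+1) &
  exists2 m, (m < b.2)%N & (b.1.2 (leaf t)).1 m <> (b.1.2 t.+1).1 m].
have /choice[next nextP] : forall ta : nat * state, exists b : state,
    avoiding fs ta.1.+1 ta.2.1.1 ta.2.1.2 ->
    avoiding fs ta.1.+2 b.1.1 b.1.2 /\ step ta.1 ta.2 b.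
  move=> [t [[x0 L0] n]] /=.
  case: (pselect (avoiding fs t.+1 x0 L0)) => [av|nav]; last by exists (x0, L0, n).
  have [x' [L' [av' sm ag neq]]] := split_leaf n (leafP t : (_ < t.+1)%N) av.
  have [q Lq] : exists q, (L' (leaf t)).1 q <> (L' t.+1).1 q.
    by apply: contra_notP neq => /forallNP nq; apply/funext => q; exact: contrapT.
  exists (x', L', (n + q).+1) => _; split=> //; split=> //=; first by lia.
  by exists q => //; lia.
pose st := fix st t : state := if t is t'.+1 then next (t', st t') else (x, fun=> (y, g), 0).
have st_av t : avoiding fs t.+1 (st t).1.1 (st t).1.2.
  elim: t => [|t IH] /=; last exact: (nextP (t, st t) IH).1.
  by move=> i _; split=> // m; exact: ne.
have st_step t : step t (st t) (st t.+1) := (nextP (t, st t) (st_av t)).2.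
have st_ge t : (t <= (st t).2)%N.
  by elim: t => // t IH; have [+ _ _ _] := st_step t; lia.
have st_same t d : ((st t).2 <= (st (t + d)).2)%N /\
    same t.+1 (st t).2 (st t).1.1 (st t).1.2 (st (t + d)).1.1 (st (t + d)).1.2.
  elim: d => [|d [IH1 [IH2 IH3]]]; first by rewrite addn0.
  rewrite addnS; have [lt [ag1 ag2] _ _] := st_step (t + d).
  split; first by lia.
  split=> [m mn|i it]; first by rewrite IH2// ag1//; lia.
  by apply: agree2_trans (IH3 i it) (agree2_le IH1 (ag2 i _)); lia.
pose X : baire := fun m => (st m.+1).1.1 m.
(* At stage [(i + m).+1] leaf [i] already exists and the precision exceeds [m]. *)
pose LL : leaves := fun i => (fun m => ((st (i + m).+1).1.2 i).1 m,
                              fun m => ((st (i + m).+1).1.2 i).2 m).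
have lim_same t : same t.+1 (st t).2 X LL (st t).1.1 (st t).1.2.
  split=> [m mn|i it].
    have [_ [ag1 _]] := st_same m.+1 t; have [_ [ag2 _]] := st_same t m.+1.
    by rewrite ag2// addnC /X ag1//; exact: st_ge.
  split=> m mn /=; have ge := st_ge (i + m).+1.
    have [_ [_ /(_ i) ag1]] := st_same (i + m).+1 t.
    have [_ [_ /(_ i it)[ag2 _]]] := st_same t (i + m).+1.
    have [|ag1' _] := ag1; first by lia.
    by rewrite ag2// (addnC t) ag1'//; lia.
  have [_ [_ /(_ i) ag1]] := st_same (i + m).+1 t.
  have [_ [_ /(_ i it)[_ ag2]]] := st_same t (i + m).+1.
  have [|_ ag1'] := ag1; first by lia.
  by rewrite ag2// (addnC t) ag1'//; lia.
apply: (@perfect_section_uncountable X LL) (cnt X).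
  move=> i; apply: pclosed_limit => n.
  have [ag1 ag2] := lim_same (i + n); have ge := st_ge (i + n).
  exists (st (i + n)).1.1, ((st (i + n)).1.2 i); split.
  - by have [] := st_av (i + n) i; first by lia.
  - by move=> m mn; apply: ag1; lia.
  - by apply: agree2_le (ag2 i _); lia.
(* The valuation of [t.+1] is [i], so stage [t] splits leaf [i], and [t] is large enough for
   precision [n]. *)
move=> i n; pose t := (2 ^ i * (n.*2).+1).-1.
have tE : t.+1 = (2 ^ i * (n.*2).+1)%N by rewrite prednK// muln_gt0 expn_gt0.
have leaf_t : leaf t = i.
  rewrite /leaf tE lognM ?expn_gt0// pfactorK// lognE /= dvdn2 /= odd_double /=.
  by rewrite addn0.
have tn : (n <= t)%N.
  have : (0 < 2 ^ i)%N by rewrite expn_gt0.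
  nia.
have [lt [ag1 ag2] ag3 [q qlt neq]] := st_step t; rewrite leaf_t in ag3 neq.
have it : (i <= t)%N by rewrite -leaf_t.
have [_ Lt] := lim_same t; have [_ LSt] := lim_same t.+1.
exists t.+1; split.
  apply: (@agree2_le _ (st t).2); first by have := st_ge t; lia.
  apply: agree2_trans (Lt i _) _; first by lia.
  apply: agree2_trans ag3 _; apply: agree2_sym.
  by apply: agree2_le (LSt t.+1 _); [exact: ltnW|lia].
(* The coordinate [q] lies below the precision of stage [t.+1], so the difference seen there
   survives in the limit. *)
move=> eqL; apply: neq.
have [|e1 _] := LSt i; first by lia.
have [|e2 _] := LSt t.+1; first by lia.
by rewrite -e1// -e2// eqL.
Qed.

End Generic.
End LusinNovikov.

(** The functions are total and may take values outside the sections of [B];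
    [quasi_order_generators] therefore uses each of them only where its value lies in the
    section. *)
Theorem lusin_novikov (B : set (nat + nat -> nat)) :
  analytic B -> (forall x, countable [set y | B (copair x y)]) ->
  exists2 f, measurable_family f &
    forall x y, B (copair x y) -> exists m, y = f m x.
Proof.
move=> [F [cF BF]] cnt.
have [fs mfs gfs] := exists_generic_family F.
exists fs => // x y /BF[g Fg]; apply: (generic_family_covers cF mfs gfs) Fg => x'.
by apply: sub_countable (cnt x'); apply: subset_card_le => y' [g' Fg']; apply/BF; exists g'.
Qed.

(** * Coding standard Borel spaces by integer sequences *)

Section MetricCode.
Import Order.TTheory GRing.Theory Num.Theory.
Local Open Scope ring_scope.
Context {R : realType} {P : metricType R}.
Implicit Types (x y : P) (z : nat -> nat) (U : set P).

Lemma metric_ball_open x (e : R) : open (ball x e).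
Proof.
rewrite openE => y; rewrite ballEmdist /= => xy.
have e0 : 0 < e - mdist x y by rewrite subr_gt0.
apply: filterS (nbhsx_ballx y _ e0) => w; rewrite !ballEmdist /= => yw.
by rewrite (le_lt_trans (metric_triangle x y w))// -ltrBrDl.
Qed.

Lemma metric_ball_eq x y : (forall e : R, 0 < e -> ball x e y) -> x = y.
Proof.
move=> xy; apply: mdist_positivity; apply/eqP; rewrite eq_le mdist_ge0 andbT.
by apply/ler_addgt0Pl => e e0; have := xy _ e0; rewrite ballEmdist /= addr0 => /ltW.
Qed.

Let r (j : nat) : R := j.+1%:R^-1.

Let r_gt0 j : 0 < r j. Proof. by rewrite invr_gt0. Qed.

Let r_le j k : (j <= k)%N -> r k <= r j.
Proof. by move=> jk; rewrite lef_pV2 ?posrE// ler_nat. Qed.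

Let r_small (c : nat) (e : R) : 0 < e -> exists n, forall k, (n <= k)%N -> r k *+ c < e.
Proof.
move=> e0; have e0' : 0 < e / c.+1%:R by rewrite divr_gt0.
have [n _ nP] := near_infty_natSinv_lt (PosNum e0').
exists n => k nk; have /= := nP k nk; rewrite ltr_pdivlMr// => /le_lt_trans; apply.
by rewrite -[leLHS]mulr_natr ler_pM2l ?r_gt0// ler_nat.
Qed.

Variable d : nat -> P.
Hypothesis dense_d : forall x (e : R), 0 < e -> exists i, ball (d i) e x.

Definition metric_code x : nat -> nat := fun j => least (fun i => ball (d i) (r j) x).

Let code_ball x j : ball (d (metric_code x j)) (r j) x.
Proof. exact: (@least_spec (fun i => ball (d i) (r j) x)) (dense_d x (r_gt0 j)). Qed.

Lemma metric_code_inj : injective metric_code.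
Proof.
move=> x y xy; apply: metric_ball_eq => e /(r_small 2)[n /(_ n (leqnn n)) ne].
have /ball_sym bx := code_ball x n; have := code_ball y n; rewrite -xy => by_.
by apply: le_ball (ball_triangle bx by_); rewrite -mulr2n ltW.
Qed.

Lemma metric_code_measurable : coord_measurable (borel P) metric_code.
Proof.
move=> j k; apply: sa_least => [|i]; first exact: smallest_sigma_algebra.
by apply: sub_sigma_algebra; exact: metric_ball_open.
Qed.

(* [z] approximates [x]; then membership of [x] in an open set can be read off [z]. *)
Let approx z x := forall j, ball (d (z j)) (r j *+ 3) x.
Let visible U z := exists n, ball (d (z n)) (r n *+ 3) `<=` U.

Let visibleP U z x : open U -> approx z x -> U x <-> visible U z.
Proof.
move=> oU zx; split=> [Ux|[n]]; last by apply; exact: zx.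
(* Both [x] and any [y] in the ball are within [r n *+ 3] of [d (z n)], hence within [r n *+ 6] of
   each other. *)
have /nbhs_ballP[e /= /(r_small 6)[n /(_ n (leqnn n)) ne] eU] : nbhs x U.
  by apply: open_nbhs_nbhs.
exists n => y zy; apply: eU; apply: le_ball (ball_triangle (ball_sym (zx n)) zy).
by rewrite -mulrnDr ltW.
Qed.

Let approx_code x : approx (metric_code x) x.
Proof.
by move=> j; apply: le_ball (code_ball x j); rewrite -[leLHS]mulr1n ler_pMn2l.
Qed.

(** For fixed [n] and [i] the inclusion of a ball in [U] is a constant proposition, so [U] may be
    arbitrary. *)
Let borel_visible U : seq_borel nat (visible U).
Proof.
apply: (@sa_eq _ _ [set z | exists n i, z n = i /\ ball (d i) (r n *+ 3) `<=` U]); last first.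
  by move=> z; split=> [[n [_ [<- sub]]]|[n sub]]; exists n => //; exists (z n).
apply: (sa_exists (seq_borel_sa _)
  (A := fun n => [set z | exists i, z n = i /\ ball (d i) (r n *+ 3) `<=` U])) => n.
apply: (sa_exists (seq_borel_sa _)
  (A := fun i => [set z | z n = i /\ ball (d i) (r n *+ 3) `<=` U])) => i.
apply: (sa_and (seq_borel_sa _) (A := [set z | z n = i])); first exact: seq_borel_coord.
exact: sa_cst.
Qed.

Lemma metric_code_open U : open U -> exists2 D, seq_borel nat D & U = metric_code @^-1` D.
Proof.
move=> oU; exists (visible U); first exact: borel_visible.
by apply/seteqP; split=> x /(visibleP oU (approx_code x)).
Qed.

Let coherent z := forall jk : nat * nat, ball (d (z jk.1)) (r jk.1 + r jk.2) (d (z jk.2)).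

Let coherent_limit z : complete_space P -> coherent z -> exists x, approx z x.
Proof.
move=> cP cz.
have [|x zx] := cP (d \o z @ \oo) _.
  apply: cauchy_exP => e /(r_small 2)[n nP]; exists (d (z n)).
  exists n => // k /= nk; apply: le_ball (cz (n, k)) => /=.
  by rewrite (le_trans _ (ltW (nP n (leqnn n))))// mulr2n lerD2l r_le.
exists x => j.
have [n _ nP] := zx _ (nbhsx_ballx x _ (r_gt0 j)).
have /= xz := nP (maxn n j) (leq_maxl _ _).
(* The distances [r j], [r (maxn n j)] and [r j] add up to at most [r j *+ 3], whence the factor in
   [approx]. *)
apply: le_ball (ball_triangle (cz (j, maxn n j)) (ball_sym xz)) => /=.
by rewrite !mulrS addr0 addrA lerD2r lerD2l r_le// leq_maxr.
Qed.

(** A sequence is a code exactly when it is coherent, hence has a limit by completeness, and each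
    entry is the least index that this limit allows. Visibility expresses the second condition
    without mentioning the limit. *)
Lemma metric_code_range : complete_space P -> seq_borel nat (range metric_code).
Proof.
move=> cP.
pose good z := coherent z /\ forall j, exists a, z j = a /\
  (visible (ball (d a) (r j)) z /\
   forall i, (i < a)%N -> ~ visible (ball (d i) (r j)) z).
apply: (@sa_eq _ _ good); last first.
  move=> z; split=> [[cz vz]|[x _ <-]].
    have [x zx] := coherent_limit cP cz; exists x => //; apply/funext => j.
    apply/leastP; left; have [a [-> [va nva]]] := vz j.
    split=> [|i ia]; first exact/(visibleP (@metric_ball_open _ _) zx).
    by move=> /(visibleP (@metric_ball_open _ _) zx); exact: nva.
  split=> [[j k] /=|j]; first exact: ball_triangle (code_ball x j) (ball_sym (code_ball x k)).
  exists (metric_code x j); split=> //; split.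
    exact/(visibleP (@metric_ball_open _ _) (approx_code x)).
  move=> i ia /(visibleP (@metric_ball_open _ _) (approx_code x)).
  have [/(_ erefl)[[_ /(_ i ia)]//|[c0 _]]] := leastP (fun i => ball (d i) (r j) x) (metric_code x j).
  by rewrite c0 in ia.
apply: (sa_and (seq_borel_sa _)).
  apply: (sa_forall (seq_borel_sa _) (A := fun jk : nat * nat =>
    [set z | ball (d (z jk.1)) (r jk.1 + r jk.2) (d (z jk.2))])) => jk.
  apply: (@sa_eq _ _ [set z | exists ab : nat * nat, z jk.1 = ab.1 /\
      (z jk.2 = ab.2 /\ ball (d ab.1) (r jk.1 + r jk.2) (d ab.2))]); last first.
    move=> z; split=> [[[a b] [/= -> [-> ]]]//|b]; exists (z jk.1, z jk.2).
    by split.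
  apply: (sa_exists (seq_borel_sa _) (A := fun ab : nat * nat =>
    [set z | z jk.1 = ab.1 /\ (z jk.2 = ab.2 /\ ball (d ab.1) (r jk.1 + r jk.2) (d ab.2))])) => ab.
  apply: (sa_and (seq_borel_sa _) (A := [set z | z jk.1 = ab.1])); first exact: seq_borel_coord.
  apply: (sa_and (seq_borel_sa _) (A := [set z | z jk.2 = ab.2])); first exact: seq_borel_coord.
  exact: sa_cst.
apply: (sa_forall (seq_borel_sa _) (A := fun j => [set z | exists a, z j = a /\
  (visible (ball (d a) (r j)) z /\
   forall i, (i < a)%N -> ~ visible (ball (d i) (r j)) z)])) => j.
apply: (sa_exists (seq_borel_sa _) (A := fun a => [set z | z j = a /\
  (visible (ball (d a) (r j)) z /\
   forall i, (i < a)%N -> ~ visible (ball (d i) (r j)) z)])) => a.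
apply: (sa_and (seq_borel_sa _) (A := [set z | z j = a])); first exact: seq_borel_coord.
apply: (sa_and (seq_borel_sa _) (A := visible _)); first exact: borel_visible.
apply: (sa_forall (seq_borel_sa _) (A := fun i =>
  [set z | (i < a)%N -> ~ visible (ball (d i) (r j)) z])) => i.
apply: (sa_imply (seq_borel_sa _) (A := [set z | ~ visible (ball (d i) (r j)) z])) => _.
exact: (sa_not (seq_borel_sa _) (borel_visible _)).
Qed.

End MetricCode.

Definition borel_coding (X : Type) (SX : set (set X)) (c : X -> nat -> nat) : Prop :=
  [/\ injective c, seq_borel nat (range c) &
      forall A, SX A <-> exists2 D, seq_borel nat D & A = c @^-1` D].

Lemma standard_borel_coding (R : realType) (X : Type) (SX : set (set X)) :
  standard_borel R SX -> exists c, borel_coding SX c.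
Proof.
move=> [P [f [g [cP [D cD dD] fK gK [mf mg]]]]].
have SXE A : SX A <-> borel P (g @^-1` A).
  split=> [/mg//|/mf]; congr SX; apply/seteqP; split=> x /=; by rewrite fK.
(* An empty space has no dense sequence and is treated apart, where any function is a coding. *)
case: (pselect (exists x : P, True)) => [[p0 _]|noP]; last first.
  have eqX (A B : set X) : A = B by apply/seteqP; split=> x; case: noP; exists (f x).
  exists (fun _ _ => 0%N); split=> [x|//|A]; first by case: noP; exists (f x).
    rewrite (_ : range _ = set0); first by case: (seq_borel_sa nat).
    by apply/seteqP; split=> // z [x]; case: noP; exists (f x).
  split=> _; first by exists set0; [case: (seq_borel_sa nat)|exact: eqX].
  rewrite (eqX A (f @^-1` set0)); apply: mf.
  exact: sigma_algebra0.
have [d dP] := countable_enum p0 cD.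
have dense_d x (e : R) : (0 < e)%R -> exists i, ball (d i) e x.
  move=> e0; have [|y [xy Dy]] := dD (ball x e) _ (metric_ball_open _ _).
    by exists x; exact: ballxx.
  by have [i iy] := dP y Dy; exists i; rewrite iy; exact: ball_sym.
pose c := metric_code d.
have borelE B : borel P B <-> exists2 D, seq_borel nat D & B = c @^-1` D.
  split=> [|[E bE ->]]; last first.
    apply: coord_measurable_preimage bE; first exact: smallest_sigma_algebra.
    exact: metric_code_measurable.
  move: B; apply: smallest_sub => [|U oU]; last exact: metric_code_open.
  have := sigma_algebra_preimage setT c (seq_borel_sa nat).
  congr sigma_algebra; apply/seteqP; split=> B.
    by move=> [E bE <-]; exists E => //; rewrite setTI.
  by move=> [E bE ->]; exists E => //; rewrite setTI.
exists (c \o f); split.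
- by apply: inj_comp; [exact: metric_code_inj|exact: can_inj fK].
- rewrite (_ : range (c \o f) = range c); first exact: metric_code_range.
  apply/seteqP; split=> z [x _ <-]; first by exists (f x).
  by exists (g x) => //=; rewrite gK.
- move=> A; split=> [/SXE/borelE[E bE gA]|[E bE ->]].
    by exists E => //; rewrite comp_preimage -gA; apply/seteqP; split=> x /=; rewrite fK.
  by apply/SXE/borelE; exists E => //; apply/seteqP; split=> x /=; rewrite gK.
Qed.

(** * The Cantor space and its powers *)

Section FiniteIndicators.
Variable I : countType.

Definition agree_below n (x y : I -> bool) := forall i, (pickle i < n)%N -> x i = y i.

Definition finite_ind (s : seq I) : I -> bool := fun i => i \in s.

Lemma finite_ind_dense n (x : I -> bool) : exists s, agree_below n x (finite_ind s).
Proof.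
exists [seq i <- pmap unpickle (iota 0 n) | x i] => i ilt.
rewrite /finite_ind mem_filter mem_pmap; case: (x i) => //=.
by apply/esym/mapP; exists (pickle i); rewrite ?pickleK// mem_iota.
Qed.

(** An open set is a countable union of cylinders, each centred at the indicator of a finite set and
    named by its length and that set. *)
Lemma sa_cylinder_union (T : Type) (S : set (set T)) (h : T -> I -> bool)
    (U : set (I -> bool)) : sigma_algebra setT S ->
  (forall i b, S [set t | h t i = b]) ->
  (forall x, U x -> exists n, forall y, agree_below n x y -> U y) ->
  S (h @^-1` U).
Proof.
move=> saS Sh oU.
pose cyl (p : nat * seq I) := forall y, agree_below p.1 y (finite_ind p.2) -> U y.
apply: (@sa_eq _ _ [set t | exists p, cyl p /\ agree_below p.1 (h t) (finite_ind p.2)]).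
  apply: (sa_exists saS (A := fun p => [set t | cyl p /\ agree_below p.1 (h t) (finite_ind p.2)])) => p.
  apply: (sa_and saS); first exact: sa_cst.
  apply: (sa_forall saS (A := fun i => [set t | (pickle i < p.1)%N -> h t i = finite_ind p.2 i])) => i.
  exact: (sa_imply saS (A := [set t | h t i = finite_ind p.2 i])).
move=> t; split=> [[p [Up tp]]|Ut]; first exact: Up.
have [n nU] := oU _ Ut; have [s ts] := finite_ind_dense n (h t).
exists (n, s); split=> // y ys; apply: nU => i ilt.
by rewrite ts// ys.
Qed.

End FiniteIndicators.

(** The product topology is the supremum of the topologies induced by the coordinates, and the
    filter of cylinders at [x] refines the neighbourhoods of each. *)
Lemma nbhs_cantor_space (x : cantor_space) (U : set cantor_space) :
  nbhs x U -> exists n, forall y : cantor_space, (forall i, (i < n)%N -> x i = y i) -> U y.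
Proof.
pose cyl n := [set y : cantor_space | forall i, (i < n)%N -> x i = y i].
pose F := filter_from [set: nat] cyl.
have FF : Filter F.
  apply: filter_from_filter; first by exists 0.
  move=> i j _ _; exists (maxn i j) => // y yij.
  by split=> k klt; apply: yij; rewrite leq_max klt ?orbT.
suff /[apply] -[n _ nU] : F --> x by exists n => y /nU.
apply/cvg_sup => i A /= [_ [[B Bop <-] Bx sBA]].
by exists i.+1 => // y yi; apply: sBA => /=; rewrite -yi.
Qed.

Lemma open_cantor_coord k b : open [set y : cantor_space | y k = b].
Proof.
rewrite openE => y /= yk.
have := @proj_continuous nat (fun=> bool) k y [set b].
by apply; rewrite /proj yk; exact: discrete_set1.
Qed.

Lemma borel_cantor_coord k b : borel cantor_space [set y | y k = b].
Proof. by apply: sub_sigma_algebra; exact: open_cantor_coord. Qed.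

Lemma cantor_measurable (T : Type) (S : set (set T)) (h : T -> cantor_space) :
  sigma_algebra setT S -> (forall k b, S [set t | h t k = b]) ->
  forall B, borel cantor_space B -> S (h @^-1` B).
Proof.
move=> saS Sh; apply: (generated_preimage saS) => U oU.
apply: (sa_cylinder_union saS Sh) => x Ux.
have [n nU] := nbhs_cantor_space (open_nbhs_nbhs (conj oU Ux)).
by exists n => y xy; exact: nU.
Qed.

Lemma borel_omega_sa : sigma_algebra setT borel_omega.
Proof. exact: smallest_sigma_algebra. Qed.

Lemma borel_omega_coord w k b : borel_omega [set u | u w k = b].
Proof.
apply: sub_sigma_algebra; exists w, [set y | y k = b]; split=> //.
exact: borel_cantor_coord.
Qed.

Lemma omega_measurable (T : Type) (S : set (set T)) (h : T -> Momega -> cantor_space) :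
  sigma_algebra setT S -> (forall w k b, S [set t | h t w k = b]) ->
  borel_map S borel_omega h.
Proof.
move=> saS Sh; apply: (generated_preimage saS) => _ [w [B [bB ->]]].
exact: (cantor_measurable saS (Sh w)).
Qed.

(** * A complete separable metric on bit functions over a countable type *)

Definition bitfun (R : realType) (I : countType) : Type := I -> bool.

Section BitfunMetric.
Import Order.TTheory GRing.Theory Num.Theory.
Local Open Scope ring_scope.
Variables (R : realType) (I : countType).
Implicit Types x y z : I -> bool.

Let r (n : nat) : R := n.+1%:R^-1.

Let r_gt0 n : 0 < r n. Proof. by rewrite invr_gt0. Qed.

Let r_le m n : (r m <= r n) = (n <= m)%N.
Proof. by rewrite lef_pV2 ?posrE// ler_nat. Qed.

Let first_diff x y := least (fun n => exists2 i, pickle i = n & x i <> y i).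

Definition bitfun_dist x y : R := if pselect (x = y) then 0 else r (first_diff x y).

Let bitfun_dist_le x y n : bitfun_dist x y <= r n <-> agree_below n x y.
Proof.
rewrite /bitfun_dist; case: pselect => /= [->|xy]; first by split=> // _; exact: ltW.
rewrite r_le; have [/(_ erefl)[[[i ei ne] min]|[_ no]] _] :=
  leastP (fun n => exists2 i, pickle i = n & x i <> y i) (first_diff x y).
  split=> [nd j jn|ag].
    by apply: contrapT => jne; apply: (min (pickle j)); [exact: leq_trans jn nd|exists j].
  by rewrite leqNgt; apply/negP => dn; apply: ne; apply: ag; rewrite ei.
case: xy; apply/funext => i; apply: contrapT => ne.
by apply: (no (pickle i)); exists i.
Qed.

Let distxx x : bitfun_dist x x = 0.
Proof. by rewrite /bitfun_dist; case: pselect. Qed.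

Let dist_positivity x y : bitfun_dist x y = 0 -> x = y.
Proof.
by rewrite /bitfun_dist; case: pselect => //= _ /eqP; rewrite gt_eqF.
Qed.

Let dist_sym x y : bitfun_dist x y = bitfun_dist y x.
Proof.
have le u v : bitfun_dist u v <= bitfun_dist v u.
  rewrite {2}/bitfun_dist; case: pselect => /= [->|vu]; first by rewrite distxx.
  apply/bitfun_dist_le => i ilt; have /bitfun_dist_le/(_ i ilt)// : bitfun_dist v u <= r (first_diff v u).
  by rewrite /bitfun_dist; case: pselect.
by apply/eqP; rewrite eq_le !le.
Qed.

(** The distance is even an ultrametric: [x] and [z] agree as far as both agree with [y]. *)
Let dist_triangle y x z : bitfun_dist x z <= bitfun_dist x y + bitfun_dist y z.
Proof.
case: (pselect (x = y)) => [<-|xy]; first by rewrite distxx add0r.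
case: (pselect (y = z)) => [<-|yz]; first by rewrite distxx addr0.
have exy : bitfun_dist x y = r (first_diff x y) by rewrite /bitfun_dist; case: pselect.
have eyz : bitfun_dist y z = r (first_diff y z) by rewrite /bitfun_dist; case: pselect.
have /bitfun_dist_le agxy : bitfun_dist x y <= r (first_diff x y) by rewrite exy.
have /bitfun_dist_le agyz : bitfun_dist y z <= r (first_diff y z) by rewrite eyz.
apply: (@le_trans _ _ (r (minn (first_diff x y) (first_diff y z)))).
  apply/bitfun_dist_le => i; rewrite leq_min => /andP[ixy iyz].
  by rewrite agxy ?agyz.
by rewrite exy eyz /minn; case: ifP => _; rewrite (lerDl, lerDr) ltW.
Qed.

HB.instance Definition _ := gen_eqMixin (bitfun R I).
HB.instance Definition _ := gen_choiceMixin (bitfun R I).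
HB.instance Definition _ := @isMetric.Build R (bitfun R I) bitfun_dist
  distxx dist_positivity dist_sym dist_triangle.

Let r_small (e : R) : 0 < e -> exists n, r n < e.
Proof.
by move=> e0; have [n _ nP] := near_infty_natSinv_lt (PosNum e0); exists n; exact: (nP n (leqnn n)).
Qed.

Lemma nbhs_bitfun (x : bitfun R I) (U : set (bitfun R I)) :
  nbhs x U <-> exists n, forall y : bitfun R I, agree_below n x y -> U y.
Proof.
split=> [/nbhs_ballP[e /= /r_small[n ne] eU]|[n nU]].
  exists n => y /bitfun_dist_le xy; apply: eU; rewrite ballEmdist /=.
  exact: le_lt_trans xy ne.
apply: filterS (nbhsx_ballx x (r n) (r_gt0 n)) => y; rewrite ballEmdist /= => xy.
by apply: nU; apply/bitfun_dist_le; exact: ltW.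
Qed.

Lemma bitfun_complete : complete_space (bitfun R I).
Proof.
move=> F PF /cauchyP cF.
have /choice[x xP] n : exists x : bitfun R I, F [set y | agree_below n x y].
  have [x Fx] := cF _ (r_gt0 n); exists x; apply: filterS Fx => y.
  by rewrite ballEmdist /= => /ltW/bitfun_dist_le.
exists (fun i => x (pickle i).+1 i) => U /nbhs_bitfun[n nU].
apply: filterS (xP n) => y xy; apply: nU => i ilt.
rewrite -xy//; have [w [w1 w2]] := filter_ex (filterI (xP n) (xP (pickle i).+1)).
by rewrite w2// w1.
Qed.

Lemma bitfun_separable : separable (bitfun R I).
Proof.
exists (range (@finite_ind I : seq I -> bitfun R I)).
  exact: sub_countable (card_image_le _ _) (countableP _).
move=> U [x Ux] oU; have /nbhs_bitfun[n nU] := open_nbhs_nbhs (conj oU Ux).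
have [s xs] := finite_ind_dense n x.
by exists (finite_ind s); split; [exact: nU|exists s].
Qed.

Lemma borel_bitfun_coord (i : I) b : borel (bitfun R I) [set x | x i = b].
Proof.
apply: sub_sigma_algebra; rewrite /= openE => x /= xi; apply/nbhs_bitfun.
by exists (pickle i).+1 => y xy /=; rewrite -xy.
Qed.

End BitfunMetric.

Lemma borel_omega_standard (R : realType) : standard_borel R borel_omega.
Proof.
pose I : countType := (seq nat * nat)%type.
exists (bitfun R I), (fun u p => u p.1 p.2), (fun x w k => x (w, k)); split.
- exact: bitfun_complete.
- exact: bitfun_separable.
- by [].
- by move=> x; apply/funext => -[].
- split.
    apply: (generated_preimage borel_omega_sa) => U oU.
    apply: (sa_cylinder_union borel_omega_sa) => [[w k] b|x Ux].
      exact: borel_omega_coord.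
    exact/nbhs_bitfun/(open_nbhs_nbhs (conj oU Ux)).
  apply: omega_measurable => [|w k b]; first exact: smallest_sigma_algebra.
  exact: borel_bitfun_coord.
Qed.

(** * Borelness and countable sections of the shift quasi-order *)

Lemma preceq_omega_borel :
  prod_sigma borel_omega borel_omega [set p | preceq_omega p.1 p.2].
Proof.
have saP : sigma_algebra setT (prod_sigma borel_omega borel_omega).
  exact: smallest_sigma_algebra.
have coord1 w k b : prod_sigma borel_omega borel_omega [set p | p.1 w k = b].
  apply: sub_sigma_algebra; exists [set u | u w k = b], [set _ | True]; split.
  - exact: borel_omega_coord.
  - exact: (sa_cst borel_omega_sa).
  - by apply/seteqP; split=> p //= -[].
have coord2 w k b : prod_sigma borel_omega borel_omega [set p | p.2 w k = b].
  apply: sub_sigma_algebra; exists [set _ | True], [set u | u w k = b]; split.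
  - exact: (sa_cst borel_omega_sa).
  - exact: borel_omega_coord.
  - by apply/seteqP; split=> p //= -[].
(* Equality of functions becomes equality of all bits, and each of these is split by the common
   value [b]. *)
apply: (@sa_eq _ _ [set p | exists m : seq nat, forall sk : seq nat * nat,
    exists b, p.1 sk.1 sk.2 = b /\ p.2 (sk.1 ++ m) sk.2 = b]).
  apply: (sa_exists saP (A := fun m : seq nat => [set p | forall sk : seq nat * nat,
    exists b, p.1 sk.1 sk.2 = b /\ p.2 (sk.1 ++ m) sk.2 = b])) => m.
  apply: (sa_forall saP (A := fun sk : seq nat * nat => [set p |
    exists b, p.1 sk.1 sk.2 = b /\ p.2 (sk.1 ++ m) sk.2 = b])) => sk.
  apply: (sa_exists saP (A := fun b => [set p |
    p.1 sk.1 sk.2 = b /\ p.2 (sk.1 ++ m) sk.2 = b])) => b.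
  by apply: (sa_and saP); [exact: coord1|exact: coord2].
move=> [u v]; split=> [[m muv]|[m muv]]; exists m => /=.
  by apply/funext => s; apply/funext => k; have [b [/= e1 e2]] := muv (s, k); rewrite e1 -e2.
by move=> [s k]; exists (u s k); rewrite /= in muv *; rewrite muv.
Qed.

Lemma preceq_omega_countable (R : realType) :
  countable_borel_quasi_order R borel_omega preceq_omega.
Proof.
split; first exact: borel_omega_standard.
- split=> [u|u v w [m ->] [m' ->]].
    by exists [::]; apply/funext => s; rewrite /monoid_shift mulg1.
  by exists (m * m')%g; apply/funext => s; rewrite /monoid_shift mulgA.
- exact: preceq_omega_borel.
- move=> v; rewrite (_ : [set u | _] = range (fun m : Momega => monoid_shift m v)).
    exact: sub_countable (card_image_le _ _) (countableP _).
  by apply/seteqP; split=> [u [m ->]|u [m _ <-]]; exists m.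
Qed.

(** * The reduction *)

(** [SX] is given only as a set of sets; the coding exhibits it as the preimage of a
    sigma-algebra. *)
Lemma coding_sa (X : Type) (SX : set (set X)) c :
  borel_coding SX c -> sigma_algebra setT SX.
Proof.
move=> [_ _ SXE]; have := sigma_algebra_preimage setT c (seq_borel_sa nat).
congr sigma_algebra; apply/seteqP; split=> A.
  by move=> [D bD <-]; apply/SXE; exists D => //; rewrite setTI.
by move=> /SXE[D bD ->]; exists D => //; rewrite setTI.
Qed.

Lemma coding_prod (X : Type) (SX : set (set X)) c (C : set (X * X)) :
  borel_coding SX c -> prod_sigma SX SX C ->
  exists2 E, seq_borel (nat + nat) E & forall x y, C (x, y) <-> E (copair (c x) (c y)).
Proof.
move=> [_ _ SXE].
pose h (p : X * X) := copair (c p.1) (c p.2).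
suff /[apply] -[E bE <-] : prod_sigma SX SX `<=` preimage_set_system setT h (seq_borel (nat + nat)).
  by exists E => // x y; split=> [[]|].
apply: smallest_sub; first exact: sigma_algebra_preimage.
move=> _ [A [B [/SXE[D bD ->] /SXE[D' bD' ->] ->]]].
exists [set z : nat + nat -> nat | D (z \o inl) /\ D' (z \o inr)]; last first.
  by apply/seteqP; split=> p /= => [[_ []]|[]].
apply: (sa_and (seq_borel_sa _)).
  by apply: (coord_measurable_preimage (f := fun z : nat + nat -> nat => z \o inl)) bD => // j k;
    exact: seq_borel_coord.
by apply: (coord_measurable_preimage (f := fun z : nat + nat -> nat => z \o inr)) bD' => // j k;
  exact: seq_borel_coord.
Qed.

Lemma quasi_order_generators (R : realType) (X : Type) (SX : set (set X))
    (Q : X -> X -> Prop) :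
  countable_borel_quasi_order R SX Q ->
  exists2 T : nat -> X -> X, (forall n, borel_map SX SX (T n)) &
    forall x y, Q y x <-> exists n, y = T n x.
Proof.
move=> [/standard_borel_coding[c cc] [Qrefl _] bQ cQ].
have [cinj bc SXE] := cc; have saS := coding_sa cc.
have [E bE QE] := coding_prod cc bQ.
(* The arguments of [E] are swapped so that the section over [c x] codes the predecessors of [x].
   The range conditions empty all other sections and make the values decodable. *)
pose B := [set z : nat + nat -> nat | range c (z \o inl) /\
  (range c (z \o inr) /\ E (copair (z \o inr) (z \o inl)))].
have bB : seq_borel (nat + nat) B.
  have ml : coord_measurable (seq_borel (nat + nat)) (fun z : nat + nat -> nat => z \o inl).
    by move=> j k; exact: seq_borel_coord.
  have mr : coord_measurable (seq_borel (nat + nat)) (fun z : nat + nat -> nat => z \o inr).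
    by move=> j k; exact: seq_borel_coord.
  apply: (sa_and (seq_borel_sa _)); last apply: (sa_and (seq_borel_sa _)).
  - exact: (coord_measurable_preimage _ ml bc).
  - exact: (coord_measurable_preimage _ mr bc).
  - exact: (coord_measurable_preimage _ (copair_measurable mr ml) bE).
have BQ x y' : B (copair (c x) y') <-> exists2 y, y' = c y & Q y x.
  split=> [[_ [[y _ cy] Eyx]]|[y -> Qyx]].
    exists y => //; have /QE : E (copair (c y) (c x)) by rewrite cy.
    by [].
  split; first by exists x.
  by split; [exists y|apply/(QE y x)].
have cntB x' : countable [set y' | B (copair x' y')].
  case: (pselect (range c x')) => [[x _ <-]|nx]; last first.
    rewrite (_ : [set y' | _] = set0); first exact: countable0.
    by apply/seteqP; split=> // y' [].
  rewrite (_ : [set y' | _] = c @` [set y | Q y x]); first exact: sub_countable (card_image_le _ _) (cQ x).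
  apply/seteqP; split=> y'; first by move=> /BQ[y -> Qyx]; exists y.
  by move=> [y Qyx <-]; apply/BQ; exists y.
have [f mf fB] := lusin_novikov (analytic_borel bB) cntB.
pose H n x := B (copair (c x) (f n (c x))).
(* Where [f n] gives no predecessor, the identity is used instead, which reflexivity allows. *)
have /choice[T0 T0P] : forall nx : nat * X, exists y,
    (H nx.1 nx.2 -> c y = f nx.1 (c nx.2)) /\ (~ H nx.1 nx.2 -> y = nx.2).
  move=> [n x] /=; case: (pselect (H n x)) => [Hx|nH]; last by exists x.
  by have [_ [[y _ cy] _]] := Hx; exists y; split.
pose T n x := T0 (n, x).
have TH n x : H n x -> c (T n x) = f n (c x) := (T0P (n, x)).1.
have TN n x : ~ H n x -> T n x = x := (T0P (n, x)).2.
have mc : coord_measurable SX c.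
  by move=> j k; apply/SXE; exists [set z | z j = k] => //; exact: seq_borel_coord.
have mfc n : coord_measurable SX (fun x => f n (c x)).
  by move=> j k; exact: (coord_measurable_preimage saS mc (mf n j k)).
exists T => [n A SA|x y].
  have [D bD AD] := (SXE A).1 SA.
  apply: (@sa_eq _ _ [set x | (H n x /\ D (f n (c x))) \/ (~ H n x /\ A x)]).
    have SH : SX (H n).
      exact: (coord_measurable_preimage saS (copair_measurable mc (mfc n)) bB).
    apply: (sa_or saS); apply: (sa_and saS) => //.
      exact: (coord_measurable_preimage saS (mfc n) bD).
    exact: (sa_not saS).
  move=> x /=; rewrite {2}AD /=; case: (pselect (H n x)) => Hx.
    by rewrite (TH _ _ Hx); split=> [[[]//|[]]//|]; left.
  rewrite (TN _ _ Hx) AD /=; split=> [[[]//|[]]//|]; by right.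
split=> [Qyx|[n ->]].
  have [n en] : exists n, c y = f n (c x) by apply: fB; apply/BQ; exists y.
  exists n; apply: cinj; rewrite TH// /H -en; apply/BQ; by exists y.
case: (pselect (H n x)) => [Hx|/TN->//].
have /BQ[y' fy Qyx] := Hx; suff -> : T n x = y' by [].
by apply: cinj; rewrite TH.
Qed.

Section Reduction.
Variables (X : Type) (SX : set (set X)) (c : X -> nat -> nat) (T : nat -> X -> X).

(** With [foldr] the last letter acts first, so [s ++ m] acts as [m] followed by [s], in accordance
    with the shift. *)
Definition word_act (w : seq nat) (x : X) : X := foldr T x w.

(** The indicator of the graph of [z]: each bit tests a single coordinate, and [z] can be
    recovered. *)
Definition bits (z : nat -> nat) : cantor_space :=
  fun k => if unpickle k is Some ia then z ia.1 == ia.2 else false.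

Lemma bits_inj : injective bits.
Proof.
move=> z z' zz'; apply/funext => i.
have := congr1 (fun u : cantor_space => u (pickle (i, z i))) zz'.
by rewrite /bits pickleK /= eqxx => /esym/eqP.
Qed.

Definition orbit_map (x : X) : Momega -> cantor_space :=
  fun w => bits (c (word_act w x)).

Lemma orbit_map_shift (m : Momega) x : orbit_map (word_act m x) = monoid_shift m (orbit_map x).
Proof. by apply/funext => s; rewrite /orbit_map /monoid_shift /word_act foldr_cat. Qed.

Lemma orbit_map_measurable : borel_coding SX c -> (forall n, borel_map SX SX (T n)) ->
  borel_map SX borel_omega orbit_map.
Proof.
move=> cc mT; have saS := coding_sa cc; have [_ _ SXE] := cc.
have mw w : borel_map SX SX (word_act w).
  elim: w => [|n w IH] A SA //; exact: IH (mT n A SA).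
apply: omega_measurable => // w k b; rewrite /orbit_map /bits.
case: (unpickle k) => [[i a] /=|]; last exact: sa_cst.
have Sia : SX [set x | c (word_act w x) i = a].
  apply: (mw w [set x | c x i = a]); apply/SXE.
  by exists [set z | z i = a] => //; exact: seq_borel_coord.
case: b.
  by apply: (sa_eq Sia) => x; split=> /eqP.
by apply: (sa_eq (sa_not saS Sia)) => x; split=> [/eqP/negbTE|/negbT/eqP].
Qed.

End Reduction.

Theorem theorem2p4 (R : realType) :
  universal_countable_borel_quasi_order R borel_omega preceq_omega.
Proof.
split; first exact: preceq_omega_countable.
move=> X SX Q hQ; have [/standard_borel_coding[c cc] [Qrefl Qtrans] _ _] := hQ.
have [T mT QT] := quasi_order_generators hQ.
exists (orbit_map c T); first exact: orbit_map_measurable.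
move=> x y; split=> [/QT[n ->]|[m]].
  by exists [:: n]; rewrite -orbit_map_shift.
(* Evaluating at the empty word and decoding shows that [x] is the image of [y] under the word
   [m]. *)
rewrite -orbit_map_shift => /(congr1 (fun u : Momega -> cantor_space => u [::])).
have [cinj _ _] := cc; move=> /bits_inj/cinj /= ->.
(* Each letter moves down in [Q], and transitivity composes the moves. *)
elim: m => [|n m IH]; first exact: Qrefl.
by apply: Qtrans IH; apply/QT; exists n.
Qed.
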